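(* Let $\mathcal{A}$ be a finite action set, let $p(a_1,a_2,y)$ be a probability distribution on $\mathcal{A}\times\mathcal{A}\times\{+1,-1\}$, and let $\ell:\mathbb{R}\to\mathbb{R}$ be a loss function. For any scoring function $g:\mathcal{A}\times\mathcal{A}\to\mathbb{R}$ satisfying $g(a_1,a_2)=-g(a_2,a_1)$ for all $a_1,a_2\in\mathcal{A}$, and any subset $\mathcal{S}\subseteq\mathcal{A}\times\mathcal{A}$, $$\mathbb{E}_{p(a_1,a_2,y)}\big[\ell(y\,g(a_1,a_2))\big]=\mathbb{E}_{(a_1',a_2',y')=f_{\mathcal{S}}(a_1,a_2,y)}\big[\ell(y'\,g(a_1',a_2'))\big],$$ where on the right-hand side $(a_1,a_2,y)\sim p$ and $(a_1',a_2',y')=f_{\mathcal{S}}(a_1,a_2,y)$.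
   Context: For a subset $\mathcal{S}\subseteq\mathcal{A}\times\mathcal{A}$, the flip function $f_{\mathcal{S}}:\mathcal{A}\times\mathcal{A}\times\{+1,-1\}\to\mathcal{A}\times\mathcal{A}\times\{+1,-1\}$ is defined by $f_{\mathcal{S}}(a_1,a_2,y)=(a_2,a_1,-y)$ if $(a_1,a_2)\in\mathcal{S}$, and $f_{\mathcal{S}}(a_1,a_2,y)=(a_1,a_2,y)$ otherwise. *)

(* Defs.v *)
From HB Require Import structures.
From mathcomp Require Import all_boot all_order all_algebra.
From mathcomp Require Import all_classical all_reals all_analysis.

Set Implicit Arguments.
Unset Strict Implicit.
Unset Printing Implicit Defensive.

Import Order.TTheory GRing.Theory Num.Theory.

Local Open Scope ring_scope.

(* Finite nonempty types. [measurableType] inherits from [pointedType]; a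
   finite type that carries a probability distribution is nonempty anyway. *)
#[short(type="finPointedType")]
HB.structure Definition FinPointed := {T of Finite T & Pointed T}.

Definition label : Type := {y : int | y \in [:: 1; -1]}.

Definition label1 : label := exist _ 1 isT.

HB.instance Definition _ := Choice.on label.
HB.instance Definition _ := isPointed.Build label label1.

Lemma label_oppP (y : label) : - val y \in [:: 1; -1].
Proof. by case: y => y /=; rewrite !inE => /orP[] /eqP ->. Qed.

Definition label_opp (y : label) : label := exist _ (- val y) (label_oppP y).

Definition label_val (R : pzRingType) (y : label) : R := (val y)%:~R.

Definition sample (A : Type) : Type := (A * A * label)%type.

(* The sigma-algebra on samples is the full powerset, so a [probability] on
   [sample A], for [A] finite, amounts to a probability mass function. *)
Section sample_measurable.
Variable A : finPointedType.
HB.instance Definition _ := Pointed.on (sample A).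
HB.instance Definition _ := @isMeasurable.Build default_measure_display
  (sample A) discrete_measurable discrete_measurable0
  discrete_measurableC discrete_measurableU.
End sample_measurable.

Definition flip (A : finPointedType) (S : {set A * A}) (w : sample A) :
    sample A :=
  let: (a1, a2, y) := w in
  if (a1, a2) \in S then (a2, a1, label_opp y) else (a1, a2, y).

(* Main.v *)
(* Swapping the actions negates [g] and flipping the label negates [y], so the
   two integrands agree pointwise. *)
Require Import Defs.
From mathcomp Require Import all_boot all_order all_algebra.
From mathcomp Require Import all_classical all_reals all_analysis.

Local Open Scope ring_scope.

Lemma label_val_opp (R : pzRingType) (y : label) :
  label_val R (label_opp y) = - label_val R y.
Proof. by rewrite /label_val /= GRing.rmorphN. Qed.

Theorem lemma2 (R : realType) (A : finPointedType)
    (p : probability (sample A) R) (l : R -> R) (g : A -> A -> R)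
    (hg : forall a1 a2 : A, g a1 a2 = - g a2 a1)
    (S : {set A * A}) :
  ('E_p[fun w : sample A =>
      (let: (a1, a2, y) := w in l (label_val R y * g a1 a2))%R] =
   'E_p[fun w : sample A =>
      (let: (a1', a2', y') := flip S w in l (label_val R y' * g a1' a2'))%R])%E.
Proof.
(* Both expectations are taken under the same [p], so equality of the integrands as functions
   suffices; no change of variables to the law of the flipped sample is involved. *)
congr expectation; apply/funext => -[[a1 a2] y] /=.
(* Outside [S] the flip is the identity. Inside [S], fixing [hg] at [a1 a2] rewrites only the
   left-hand score, after which both arguments of [l] are minus the product of the label with
   [g a2 a1]. *)
by case: ifP => // _; rewrite label_val_opp (hg a1 a2) GRing.mulrN GRing.mulNr.
Qed.
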